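(* Let $m\ge 2$ be an integer, $A=[a]_m$, $B=[b]_m\in\mathbb{Z}_m$, and let $F_n=[f_n]_m$ $(n\in\mathbb{Z}_+)$ be a sequence in $\mathbb{Z}_m$, where $a,b,f_n\in\mathbb{Z}$. Let $d,m_1,m_2,A_i,B_i,F_{i,n}$ be as defined in the context. The following hold. 1. Let $m_1\neq1$. The general solution of the equation $B_1X_{1,n+1}=A_1X_{1,n}+F_{1,n}$ $(n\in\mathbb{Z}_+)$ over $\mathbb{Z}_{m_1}$ is $$X_{1,n}=B_1^{-n}A_1^nX_{1,0}+\sum_{s=0}^{n-1}A_1^sB_1^{-s-1}F_{1,n-s-1},\quad n\in\mathbb{N},$$ where $X_{1,0}$ is an arbitrary element of $\mathbb{Z}_{m_1}$. 2. Let $d=1$ and $m_2\ne1$. Then the equation $B_2X_{2,n+1}=A_2X_{2,n}+F_{2,n}$ $(n\in\mathbb{Z}_+)$ over $\mathbb{Z}_{m_2}$ has a unique solution, given by $$X_{2,n}=-\sum_{s=0}^{\mathrm{ind}(B_2)-1}A_2^{-s-1}B_2^sF_{2,n+s},\quad n\in\mathbb{Z}_+.$$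
   Context: $\mathbb{Z}_+$ is the set of non-negative integers, $\mathbb{N}$ the positive integers. $\mathbb{Z}_s=\mathbb{Z}/s\mathbb{Z}$ and $[t]_s$ is the class of $t\in\mathbb{Z}$ in $\mathbb{Z}_s$. For a nilpotent element $T$, $\mathrm{ind}(T)$ is its nilpotency index (least $k\ge1$ with $T^k=0$). Zeroth powers are $1$. Write $m=\prod_{j=1}^r p_j^{k_j}$ with distinct primes $p_j$ and $k_j\in\mathbb{N}$. Put $m_1=\prod_{j:\,p_j\nmid b}p_j^{k_j}$, $m_2=\prod_{j:\,p_j\mid b}p_j^{k_j}$ (empty products are $1$). Put $d=\gcd(a,b,m)$ (positive). For $i=1,2$: $A_i=[a]_{m_i}$, $B_i=[b]_{m_i}$, $F_{i,n}=[f_n]_{m_i}$. The formulas make sense: $B_1$ is invertible in $\mathbb{Z}_{m_1}$ if $m_1\neq1$; $B_2$ is nilpotent in $\mathbb{Z}_{m_2}$ if $m_2\ne1$, and then $A_2$ is invertible if $d=1$. *)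

(* Defs.v *)
From mathcomp Require Import all_boot all_order all_algebra.
From mathcomp Require Import boolp.
Set Implicit Arguments.
Unset Strict Implicit.
Unset Printing Implicit Defensive.
Import Order.TTheory GRing.Theory Num.Theory.
Local Open Scope ring_scope.

(* For b = 0 every prime divides b, hence mfree m 0 = 1 and mdiv m 0 = m. *)
Definition mfree (m : nat) (b : int) : nat :=
  (\prod_(p <- primes m | ~~ (p%:Z %| b)%Z) p ^ logn p m)%N.

Definition mdiv (m : nat) (b : int) : nat :=
  (\prod_(p <- primes m | (p%:Z %| b)%Z) p ^ logn p m)%N.

(* [t]_s.  The type 'Z_s is Z/sZ only for s > 1. *)
Definition zclass (s : nat) (t : int) : 'Z_s := t%:~R.

Definition solves (R : pzRingType) (A B : R) (F X : nat -> R) : Prop :=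
  forall n, B * X n.+1 = A * X n + F n.

Definition nilpotent (R : pzRingType) (T : R) : Prop :=
  exists k : nat, (0 < k)%N && (T ^+ k == 0).

(* The value 0 on non-nilpotent elements is a dummy. *)
Definition nilp_index (R : pzRingType) (T : R) : nat :=
  if pselect (nilpotent T) is left nilT then ex_minn nilT else 0%N.

Lemma nilp_indexP (R : pzRingType) (T : R) : nilpotent T ->
  [/\ (0 < nilp_index T)%N, T ^+ nilp_index T = 0
    & forall k, (0 < k)%N -> T ^+ k = 0 -> (nilp_index T <= k)%N].
Proof.
rewrite /nilp_index; case: pselect => // nilT _.
case: ex_minnP => k /andP[k0 /eqP Tk] kmin; split=> // j j0 Tj.
by apply: kmin; rewrite j0 Tj eqxx.
Qed.

Lemma mfree_gt0 m b : (0 < mfree m b)%N.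
Proof.
rewrite /mfree big_seq_cond; apply: prodn_cond_gt0 => p /andP[+ _].
by rewrite mem_primes expn_gt0 => /andP[/prime_gt0 ->].
Qed.

Lemma mdiv_gt0 m b : (0 < mdiv m b)%N.
Proof.
rewrite /mdiv big_seq_cond; apply: prodn_cond_gt0 => p /andP[+ _].
by rewrite mem_primes expn_gt0 => /andP[/prime_gt0 ->].
Qed.

Lemma mfree_mdiv m b : (0 < m)%N -> (mfree m b * mdiv m b)%N = m.
Proof.
move=> m0; rewrite [RHS]prod_prime_decomp // prime_decompE big_map /=.
by rewrite (bigID (fun p : nat => (p%:Z %| b)%Z)) /= mulnC.
Qed.

Lemma zclass_unitE s t : (1 < s)%N ->
  (zclass s t \is a GRing.unit) = coprime s `|t|%N.
Proof.
move=> s1; rewrite /zclass; case: t => n; first exact: unitZpE.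
by rewrite NegzE mulrNz unitrN abszN; exact: unitZpE.
Qed.

Lemma zclassX_eq0 s t k : (1 < s)%N -> (s %| `|t| ^ k)%N -> zclass s t ^+ k = 0.
Proof.
move=> s1 sdv; rewrite /zclass [t]intEsign rmorphM rmorphXn rmorphN1 exprMn.
rewrite -[X in _ * X](natrX _ `|t|%N) (_ : (`|t| ^ k)%:R = 0) ?mulr0 //.
by apply: val_inj; rewrite /= val_Zp_nat //; apply/eqP.
Qed.

Lemma zclass_mfree_unit m b : mfree m b != 1%N ->
  zclass (mfree m b) b \is a GRing.unit.
Proof.
move=> ne1; rewrite zclass_unitE; last by rewrite ltn_neqAle eq_sym ne1 mfree_gt0.
rewrite /mfree big_seq_cond; elim/big_rec: _ => [|p n /andP[+ pb] nb];
  first exact: coprime1n.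
rewrite mem_primes => /andP[pp _].
by rewrite coprimeMl nb andbT coprimeXl // prime_coprime.
Qed.

Lemma zclass_mdiv_nilpotent m b : mdiv m b != 1%N ->
  nilpotent (zclass (mdiv m b) b).
Proof.
move=> ne1; have s1 : (1 < mdiv m b)%N by rewrite ltn_neqAle eq_sym ne1 mdiv_gt0.
suff [k sdv] : exists k, (mdiv m b %| `|b| ^ k)%N.
  exists k.+1 => /=; rewrite zclassX_eq0 // expnS; exact: dvdn_mull.
rewrite /mdiv; elim/big_rec: _ => [|p n pb [k nk]]; first by exists 0%N.
by exists (logn p m + k)%N; rewrite expnD dvdn_mul // dvdn_exp2r.
Qed.

Lemma zclass_mdiv_unit m a b : mdiv m b != 1%N ->
  gcdz (gcdz a b) m%:Z = 1 -> zclass (mdiv m b) a \is a GRing.unit.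
Proof.
move=> ne1 [gcd1]; rewrite zclass_unitE; last by rewrite ltn_neqAle eq_sym ne1 mdiv_gt0.
rewrite /mdiv big_seq_cond; elim/big_rec: _ => [|p n /andP[+ pb] nb];
  first exact: coprime1n.
rewrite mem_primes => /and3P[pp _ pm].
rewrite coprimeMl nb andbT coprimeXl // prime_coprime //; apply/negP => pa.
have : (p %| 1)%N by rewrite -gcd1 !dvdn_gcd pa pm andbT.
by rewrite dvdn1 => /eqP p1; rewrite p1 in pp.
Qed.

(* Main.v *)
(** Over a commutative ring, a unit coefficient on one side lets one solve
    [B X_{n+1} = A X_n + F_n] step by step: forwards if [B] is invertible, so
    that [X_0] is free, and backwards if [A] is invertible. Going backwards [k]
    steps leaves the remainder [A^-k B^k X_{n+k}], which vanishes once
    [B^k = 0]; hence the solution is unique. *)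
Require Import Defs.
From mathcomp Require Import all_boot all_order all_algebra.
From mathcomp Require Import ring.
Set Implicit Arguments.
Unset Strict Implicit.
Unset Printing Implicit Defensive.
Import Order.TTheory GRing.Theory Num.Theory.
Local Open Scope ring_scope.

Definition forward_solution (R : comUnitRingType) (A B : R) (F : nat -> R)
    (x0 : R) (n : nat) : R :=
  B ^- n * A ^+ n * x0
  + \sum_(0 <= s < n) A ^+ s * B ^- s.+1 * F (n - s - 1)%N.

Lemma forward_solution0 (R : comUnitRingType) (A B : R) (F : nat -> R) (x0 : R) :
  forward_solution A B F x0 0 = x0.
Proof.
by rewrite /forward_solution big_geq // !expr0 invr1 !mul1r addr0.
Qed.

(** Read from right to left, this trades [B ^- n] for [B * B ^- n.+1]. The inverse powers on both
    sides of an identity then match, and [ring] can finish. *)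
Lemma mulrVS (R : comUnitRingType) (B : R) (n : nat) :
  B \is a GRing.unit -> B * B ^- n.+1 = B ^- n.
Proof. by move=> uB; rewrite exprSr invrM ?unitrX // mulrA divrr // mul1r. Qed.

(** Multiplying the sum at [n.+1] by [B] turns its term [s = 0] into [F n]. The other terms, shifted
    by one, give [A] times the sum at [n]. *)
Lemma forward_solution_solves (R : comUnitRingType) (A B : R) (F : nat -> R)
    (x0 : R) :
  B \is a GRing.unit -> solves A B F (forward_solution A B F x0).
Proof.
move=> uB n; rewrite /forward_solution big_nat_recl // !mulrDr.
rewrite [B * (A ^+ 0 * _ * _)]mulrA expr0 expr1 mul1r divrr // mul1r.
rewrite subn0 subn1 /= -addrA; congr (_ + _).
  by rewrite !mulrA mulrVS // exprS; ring.
rewrite addrC; congr (_ + _); rewrite !mulr_sumr.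
apply: eq_bigr => s _; rewrite subSS exprS.
by rewrite -(mulrVS s.+1 uB); ring.
Qed.

Lemma solves_unitP (R : comUnitRingType) (A B : R) (F X : nat -> R) :
  B \is a GRing.unit ->
  solves A B F X <-> forall n, X n = forward_solution A B F (X 0) n.
Proof.
move=> uB; have solF := forward_solution_solves A F (X 0) uB.
split=> [solX|eqX n]; last by rewrite [X n.+1]eqX [X n]eqX solF.
elim=> [|n IHn]; first by rewrite forward_solution0.
(* Cancelling [B] shows that the value at [n] determines the next one. *)
by apply: (mulrI uB); rewrite solX solF IHn.
Qed.

Lemma solves_backward (R : comUnitRingType) (A B : R) (F Y : nat -> R) k n :
  A \is a GRing.unit -> solves A B F Y ->
  Y n = A ^- k * B ^+ k * Y (n + k)%N
        - \sum_(0 <= s < k) A ^- s.+1 * B ^+ s * F (n + s)%N.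
Proof.
move=> uA solY; elim: k => [|k IHk].
  by rewrite big_geq // !expr0 invr1 !mul1r addn0 subr0.
rewrite big_nat_recr //= IHk opprD [RHS]addrCA addrC; congr (_ + _).
(* The new term comes from the equation at index [n + k], once a factor [A] is split off from
   [A ^- k]. *)
have step : A * Y (n + k)%N = B * Y (n + k.+1)%N - F (n + k)%N.
  by rewrite addnS solY addrK.
rewrite -(mulrVS k uA) (_ : _ * Y _ = A ^- k.+1 * B ^+ k * (A * Y (n + k)%N));
  last by ring.
by rewrite step (exprS B); ring.
Qed.

(** After multiplication by [B], the last term at [n.+1] contains [B ^+ k = 0]. After multiplication
    by [A], the first term at [n] is [F n], which cancels the inhomogeneity. The remaining terms
    agree after a shift. *)
Lemma solves_nilpotent (R : comUnitRingType) (A B : R) (F : nat -> R) k :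
  A \is a GRing.unit -> (0 < k)%N -> B ^+ k = 0 ->
  solves A B F
    (fun n => - \sum_(0 <= s < k) A ^- s.+1 * B ^+ s * F (n + s)%N).
Proof.
case: k => // k uA _ Bk n; rewrite !mulrN big_nat_recr //= mulrDr.
rewrite [X in _ + X]mulrA mulrCA -exprS Bk mulr0 mul0r addr0.
rewrite [in RHS]big_nat_recl // mulrDr expr0 expr1 mulr1 [A * (_ * F _)]mulrA.
rewrite divrr // mul1r.
rewrite addn0 opprD addrAC addNr add0r !mulr_sumr.
congr (- _); apply: eq_bigr => s _.
by rewrite addSnnS -(mulrVS s.+1 uA) (exprS B); ring.
Qed.

Theorem theorem2p1 (m : nat) (a b : int) (f : nat -> int) (hm : (2 <= m)%N) :
  let m1 := mfree m b in
  let m2 := mdiv m b in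
  let d := gcdz (gcdz a b) m%:Z in
  let A1 := zclass m1 a in
  let B1 := zclass m1 b in
  let F1 := fun n : nat => zclass m1 (f n) in
  let A2 := zclass m2 a in
  let B2 := zclass m2 b in
  let F2 := fun n : nat => zclass m2 (f n) in
  (m1 <> 1%N ->
    forall X1 : nat -> 'Z_m1,
      solves A1 B1 F1 X1 <->
      exists x0 : 'Z_m1, X1 0%N = x0 /\
        forall n : nat, (0 < n)%N ->
          X1 n = B1 ^- n * A1 ^+ n * x0
                 + \sum_(0 <= s < n) A1 ^+ s * B1 ^- s.+1 * F1 (n - s - 1)%N)
  /\
  (d = 1 -> m2 <> 1%N ->
    let X2 := fun n : nat =>
      - \sum_(0 <= s < nilp_index B2) A2 ^- s.+1 * B2 ^+ s * F2 (n + s)%N in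
    solves A2 B2 F2 X2 /\
    forall Y : nat -> 'Z_m2, solves A2 B2 F2 Y -> forall n : nat, Y n = X2 n).
Proof.
move=> m1 m2 d A1 B1 F1 A2 B2 F2; split=> [/eqP m1N1 X1|d1 /eqP m2N1].
  have uB := zclass_mfree_unit m1N1.
  (* The closed form is now wanted at [n = 0] too, where it reduces to the initial value. *)
  rewrite (solves_unitP _ _ _ uB); split=> [eqX|[x0 [<- eqX]] [|n]].
  - by exists (X1 0%N); split=> // n _; apply: eqX.
  - by rewrite forward_solution0.
  - exact: eqX.
(* A prime factor of [m2] divides [b] and [m], so [d = 1] prevents it from dividing [a]. *)
have uA := zclass_mdiv_unit m2N1 d1.
have [k_gt0 Bk _] := nilp_indexP (zclass_mdiv_nilpotent m2N1).
move=> X2; split; first exact: solves_nilpotent.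
move=> Y solY n.
by rewrite (solves_backward (nilp_index B2) n uA solY) Bk mulr0 mul0r add0r.
Qed.
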